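(* Let $X=\{1,2,\dots,|X|\}$ be finite and let $(X,r)$ be an involutive near-rack solution of the Yang-Baxter equation. Then $(X,r)$ is isomorphic to a solution $r'(x,y)=(\sigma_x(y),\tau(x))$ on $X$ with $$\sigma_x=\tau=\prod_{i=1}^k(2i-1,2i)\in \mathbb S_{|X|}\qquad\text{for all } x\in X,$$ where $k$ is an integer with $1\le k\le \frac{|X|}{2}$.
   Context: A set-theoretical solution of the Yang-Baxter equation is a pair $(X,r)$ with $X$ a non-empty set and $r:X\times X\to X\times X$ a bijection satisfying $(r\times \mathrm{id})(\mathrm{id}\times r)(r\times \mathrm{id})=(\mathrm{id}\times r)(r\times \mathrm{id})(\mathrm{id}\times r)$; write $r(x,y)=(\sigma_x(y),\tau_y(x))$. It is non-degenerate if all $\sigma_x,\tau_x:X\to X$ are bijective, and involutive if $r^2=\mathrm{id}_{X\times X}$. A near-rack solution is a non-degenerate solution for which $\tau_y=\tau$ is independent of $y\in X$, $\tau\neq\mathrm{id}$ and $\tau^2=\mathrm{id}$. Two solutions $(X,r)$ and $(X,r')$ are isomorphic if there is an invertible map $\varphi:X\to X$ with $(\varphi\times\varphi)r=r'(\varphi\times\varphi)$. $\mathbb S_n$ is the symmetric group on $\{1,\dots,n\}$, and $(a,b)$ denotes a transposition. *)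

(* Defs.v *)
From mathcomp Require Import all_boot all_fingroup.

Set Implicit Arguments.
Unset Strict Implicit.
Unset Printing Implicit Defensive.

Section SetTheoreticalSolutions.

Variable X : Type.
Implicit Types r : X * X -> X * X.

(* r x id and id x r on X ^ 3 = (X * X) * X *)
Definition r12 r (p : X * X * X) : X * X * X :=
  let: (x, y, z) := p in (r (x, y), z).

Definition r23 r (p : X * X * X) : X * X * X :=
  let: (x, y, z) := p in let: (y', z') := r (y, z) in (x, y', z').

Definition yang_baxter r : Prop :=
  r12 r \o r23 r \o r12 r =1 r23 r \o r12 r \o r23 r.

Definition solution r : Prop :=
  [/\ inhabited X, bijective r & yang_baxter r].

(* r (x, y) = (sigma r x y, tau r y x) *)
Definition sigma r (x y : X) : X := (r (x, y)).1.
Definition tau r (y x : X) : X := (r (x, y)).2.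

Definition nondegenerate r : Prop :=
  forall x, bijective (sigma r x) /\ bijective (tau r x).

Definition involutive_solution r : Prop := solution r /\ involutive r.

Definition near_rack_solution r : Prop :=
  [/\ solution r, nondegenerate r &
      exists t : X -> X,
        [/\ forall y, tau r y =1 t, ~ (t =1 id) & involutive t]].

Definition isomorphic r r' : Prop :=
  exists phi : X -> X,
    bijective phi /\
    forall x y, (phi (r (x, y)).1, phi (r (x, y)).2) = r' (phi x, phi y).

End SetTheoreticalSolutions.

(* The set {1, ..., n.+1} is encoded as 'I_n.+1 = {0, ..., n}:
   pt n j is the element named j, for 1 <= j <= n.+1. *)
Definition pt (n j : nat) : 'I_n.+1 := inord j.-1.

Definition pair_swaps (n k : nat) : 'S_n.+1 :=
  (\prod_(1 <= i < k.+1) tperm (pt n (2 * i - 1)%N) (pt n (2 * i)%N))%g.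

(* Main.v *)
Require Import Defs.
From mathcomp Require Import all_boot all_fingroup.
From mathcomp Require Import zify.

(** Write [r (x, y) = (sigma_x y, t x)], where [t] is the common value of the
    maps [tau_y].  The second component of [r (r (x, y)) = (x, y)] reads
    [t (sigma_x y) = y], and [t] is an involution, so every [sigma_x] equals [t]
    and [r (x, y) = (t y, t x)] ([involutive_near_rack_swap]).  Conversely every
    bijection [t] gives a solution in this way ([swap_solution]), and a map that
    conjugates [t] to [t'] is an isomorphism between the two solutions.  What
    remains is that an involution of a finite set is determined up to
    conjugation by the number [k] of its 2-cycles ([involution_conj]), and that
    [k] is positive because [t] is not the identity.

    To conjugate [t] to [pair_swaps n k], list the 2-cycles by their smaller
    elements [x < t x]: the [i]-th one (from 0) is sent to [{2i, 2i + 1}], and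
    the fixed points of [t] fill the positions from [2k] on. *)

Section SwapSolutions.

Variable X : Type.

Lemma involutive_near_rack_swap (r : X * X -> X * X) :
    involutive r -> near_rack_solution r ->
  exists t : X -> X,
    [/\ involutive t, ~ (t =1 id) & forall x y, r (x, y) = (t y, t x)].
Proof.
move=> rK [_ _ [t [tau_t t_neq_id tK]]]; exists t; split=> // x y.
have r2 a b : (r (a, b)).2 = t a by rewrite -(tau_t b).
case Er: (r (x, y)) => [a b]; have := r2 x y; rewrite Er /= => ->.
have := r2 a b; rewrite -Er rK /= => ->; by rewrite tK.
Qed.

(** Both sides of the braid relation send [(x, y, z)] to
    [(t^2 z, t^2 y, t^2 x)]. *)
Lemma swap_solution (t : X -> X) : inhabited X -> bijective t ->
  solution (fun p : X * X => (t p.2, t p.1)).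
Proof.
move=> inhX [u tK uK]; split=> //; last by case=> [[x y] z].
by exists (fun p => (u p.2, u p.1)) => -[x y] /=; rewrite ?tK ?uK.
Qed.

End SwapSolutions.

(** With the elements numbered from 0, [(2i - 1, 2i)] exchanges the values
    [2i - 2] and [2i - 1]; so below [2k] an even value goes up and an odd one
    goes down. *)
Lemma pair_swaps_val n k (j : 'I_n.+1) : 2 * k <= n.+1 ->
  pair_swaps n k j = (if j < 2 * k then if odd j then j.-1 else j.+1 else j)
    :> nat.
Proof.
elim: k => [|k IHk] le_k; first by rewrite /pair_swaps big_geq // perm1.
have {}IHk := IHk ltac:(lia).
have ptE m : m.-1 < n.+1 -> pt n m = m.-1 :> nat by move=> ?; apply: inordK.
have a_val : pt n (2 * k.+1 - 1) = 2 * k :> nat by rewrite ptE; lia.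
have b_val : pt n (2 * k.+1) = (2 * k).+1 :> nat by rewrite ptE; lia.
have -> : pair_swaps n k.+1
    = (pair_swaps n k * tperm (pt n (2 * k.+1 - 1)) (pt n (2 * k.+1)))%g.
  by rewrite /pair_swaps big_nat_recr.
rewrite permM.
case: tpermP => [/(congr1 val)|/(congr1 val)|/eqP + /eqP];
  rewrite -?val_eqE /= ?a_val ?b_val IHk;
  do !case: ifP; lia.
Qed.

Section InvolutionNormalForm.

Variables (n : nat) (t : 'I_n.+1 -> 'I_n.+1).
Hypothesis tK : involutive t.

Let lows := [set x : 'I_n.+1 | x < t x].
Let fixed := [set x : 'I_n.+1 | t x == x].
Let k := #|lows|.

(** The set splits into [lows], its image under [t], which consists of the
    points with [t x < x], and the fixed points. *)
Lemma card_lows_fixed : 2 * k + #|fixed| = n.+1.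
Proof.
have t_inj : injective t := inv_inj tK.
have mem_highs x : (x \in t @: lows) = (t x < x).
  by rewrite -{1}[x]tK mem_imset // inE tK.
have dLH : lows :&: t @: lows = set0.
  by apply/setP=> x; rewrite in_setI mem_highs !inE; case: ltngtP.
have compl : ~: (lows :|: t @: lows) = fixed.
  by apply/setP=> x; rewrite in_setC in_setU mem_highs !inE -val_eqE /=;
     case: ltngtP.
have := cardsC (lows :|: t @: lows).
rewrite compl cardsU dLH cards0 card_imset // card_ord -/k; lia.
Qed.

Definition cycle_position (x : 'I_n.+1) : nat :=
  if x < t x then 2 * index x (enum lows)
  else if t x < x then (2 * index (t x) (enum lows)).+1
  else 2 * k + index x (enum fixed).

Lemma index_low (x : 'I_n.+1) : x < t x -> index x (enum lows) < k.
Proof. by move=> x_low; rewrite /k cardE index_mem mem_enum inE. Qed.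

Lemma index_fixed x : t x = x -> index x (enum fixed) < #|fixed|.
Proof. by move=> tx; rewrite cardE index_mem mem_enum inE tx. Qed.

(** Each case carries the bound on the index, which makes the three ranges of
    positions visibly disjoint to linear arithmetic. *)
Variant position_spec (x : 'I_n.+1) : nat -> Prop :=
| PositionLow of x < t x & index x (enum lows) < k :
    position_spec x (2 * index x (enum lows))
| PositionHigh of t x < x & index (t x) (enum lows) < k :
    position_spec x (2 * index (t x) (enum lows)).+1
| PositionFixed of t x = x & index x (enum fixed) < #|fixed| :
    position_spec x (2 * k + index x (enum fixed)).

Lemma positionP x : position_spec x (cycle_position x).
Proof.
rewrite /cycle_position; case: ltngtP => [x_low|x_high|/val_inj x_fix].
- by constructor=> //; apply: index_low.
- by constructor=> //; apply: index_low; rewrite tK.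
- by constructor=> //; apply: index_fixed.
Qed.

Lemma cycle_position_lt x : cycle_position x < n.+1.
Proof. by have := card_lows_fixed; case: positionP => _; lia. Qed.

Lemma cycle_position_inj : injective cycle_position.
Proof.
move=> x y; case: positionP => Hx lt_x; case: positionP => Hy lt_y eq_xy;
  try lia.
- by apply: (@index_inj _ x (enum lows)); rewrite ?mem_enum ?inE //; lia.
- apply: (inv_inj tK).
  by apply: (@index_inj _ x (enum lows)); rewrite ?mem_enum ?inE ?tK //; lia.
- apply: (@index_inj _ x (enum fixed)); rewrite ?mem_enum ?inE ?Hx ?Hy //; lia.
Qed.

(** The positions of [x] and [t x] for [x < t x] are [2i] and [2i + 1] with the
    same [i], and the fixed points lie at [2k] or beyond; this is exactly the
    pattern of [pair_swaps n k].  An injection of a finite set into itself is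
    bijective, so [cycle_position] is the required conjugation. *)
Lemma involution_conj_lows : exists phi : 'I_n.+1 -> 'I_n.+1,
  bijective phi /\ forall x, phi (t x) = pair_swaps n k (phi x).
Proof.
exists (fun x => Ordinal (cycle_position_lt x)); split.
  by apply: injF_bij => x y /(congr1 val) /cycle_position_inj.
move=> x; apply/val_inj; rewrite /= pair_swaps_val /=; last first.
  by have := card_lows_fixed; lia.
rewrite /cycle_position tK.
case: (ltngtP x (t x)) => [x_low|x_high|/val_inj x_fix].
- by have := index_low _ x_low; do !case: ifP; lia.
- have := index_low (t x); rewrite tK => /(_ x_high); do !case: ifP; lia.
- by rewrite -x_fix; case: ifP; lia.
Qed.

End InvolutionNormalForm.

Lemma involution_conj n (t : 'I_n.+1 -> 'I_n.+1) :
    involutive t -> ~ (t =1 id) ->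
  exists (k : nat) (phi : 'I_n.+1 -> 'I_n.+1),
    [/\ 1 <= k, 2 * k <= n.+1, bijective phi &
        forall x, phi (t x) = pair_swaps n k (phi x)].
Proof.
move=> tK t_neq_id; have [phi [phi_bij phi_t]] := involution_conj_lows _ _ tK.
have card := card_lows_fixed _ _ tK.
exists #|[set x : 'I_n.+1 | x < t x]|, phi; split=> //; last by lia.
rewrite card_gt0; apply/set0Pn.
case: (pickP (fun x => t x != x)) => [x tx_neq_x|t_id]; last first.
  by case: t_neq_id => x; apply/eqP/negbFE/t_id.
case: (ltngtP x (t x)) => [x_low|x_high|/val_inj eq_x].
- by exists x; rewrite inE.
- by exists (t x); rewrite inE tK.
- by rewrite -eq_x eqxx in tx_neq_x.
Qed.

Theorem proposition3p23 (n : nat) (r : 'I_n.+1 * 'I_n.+1 -> 'I_n.+1 * 'I_n.+1)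
    (r_inv : involutive_solution r) (r_near_rack : near_rack_solution r) :
  exists (k : nat) (r' : 'I_n.+1 * 'I_n.+1 -> 'I_n.+1 * 'I_n.+1),
    [/\ (1 <= k)%N /\ (2 * k <= n.+1)%N,
        solution r',
        forall x y, r' (x, y) = (pair_swaps n k y, pair_swaps n k x) &
        isomorphic r r'].
Proof.
case: r_inv => _ rK.
have [t [tK t_neq_id rE]] := involutive_near_rack_swap _ _ rK r_near_rack.
have [k [phi [k_gt0 le_k phi_bij phi_t]]] := involution_conj _ _ tK t_neq_id.
exists k, (fun p => (pair_swaps n k p.2, pair_swaps n k p.1)); split=> //.
- apply: swap_solution; first by split; apply: ord0.
  by exists (pair_swaps n k)^-1%g; [apply: permK | apply: permKV].
- by exists phi; split=> // x y; rewrite rE /= !phi_t.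
Qed.
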